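(* Let $X$ be a compact Hausdorff semitopological semilattice with topology $\tau_X$. Then the following conditions are equivalent: (1) $w_X=\tau_X$; (2) $w^\circ_X=\tau_X$; (3) $w^\bullet_X=\tau_X$; (4) the weak$^\circ$ topology $w^\circ_X$ is Hausdorff; (5) the weak$^\bullet$ topology $w^\bullet_X$ is Hausdorff; (6) the $\mathbb I$-weak topology $w_X$ is Hausdorff; (7) $X$ is $w^\circ\tau$-separated; (8) $X$ is $w^\bullet\tau$-separated; (9) $X$ is $\mathbb I$-separated; (10) $X$ is a $W$-semilattice; (11) $X$ is a $U$-semilattice; (12) $X$ is a $V$-semilattice.
   Context: A semilattice is a commutative semigroup of idempotents, ordered by $x\le y$ iff $xy=x$; ${\uparrow}x=\{y\in X:x\le y\}$, ${\downarrow}x=\{y\in X:y\le x\}$, ${\uparrow}F=\bigcup_{y\in F}{\uparrow}y$. A semitopological semilattice is a semilattice with a topology $\tau_X$ for which the operation $X\times X\to X$, $(x,y)\mapsto xy$, is separately continuous. $\mathbb I=[0,1]$ carries the usual topology and the operation $\min$. Topologies on $X$: the weak$^\circ$ topology $w^\circ_X$ is generated by the base of all open subsemilattices of $X$; the weak$^\bullet$ topology $w^\bullet_X$ is generated by the subbase of complements to closed subsemilattices of $X$; the $\mathbb I$-weak topology $w_X$ is generated by the subbase of all sets $h^{-1}(U)$, where $U\subset\mathbb I$ is open and $h:X\to\mathbb I$ is a continuous semigroup homomorphism. $X$ is $w^\circ\tau$-separated (resp. $w^\bullet\tau$-separated) if any distinct points $x,y\in X$ have disjoint neighborhoods $O_x\in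 w^\circ_X$ (resp. $O_x\in w^\bullet_X$) and $O_y\in\tau_X$. $X$ is $\mathbb I$-separated if for any distinct $x,y\in X$ there is a continuous semigroup homomorphism $h:X\to\mathbb I$ with $h(x)\ne h(y)$. $X$ is a $U$-semilattice if for each open set $V\subset X$ and each $x\in V$ there is $v\in V$ such that ${\uparrow}v$ contains $x$ in its interior; a $W$-semilattice if for each open set $V\subset X$ and each $x\in V$ there is a finite subset $F\subset V$ such that ${\uparrow}F$ contains $x$ in its interior; a $V$-semilattice if for any points $x\not\le y$ in $X$ there is a point $v\notin{\downarrow}y$ in $X$ such that ${\uparrow}v$ contains $x$ in its interior (all interiors with respect to $\tau_X$). *)

(* Defs.v *)
From HB Require Import structures.
From mathcomp Require Import all_boot all_order all_algebra.
From mathcomp Require Import all_classical reals topology normedtype.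
Import Order.TTheory.
Import numFieldNormedType.Exports.

Set Implicit Arguments.
Unset Strict Implicit.
Unset Printing Implicit Defensive.

Local Open Scope classical_set_scope.

(* Order-theoretically a [meetSemilatticeType]; but HB cannot join that structure
   with [topologicalType] downstream of the library's ordered topological
   structures, so the semigroup operation is introduced here. *)
HB.mixin Record isSemitopologicalSemilattice X & Topological X := {
  smul : X -> X -> X ;
  smulA : associative smul ;
  smulC : commutative smul ;
  smulxx : idempotent_op smul ;
  smul_continuousr : forall a : X, continuous (smul a) ;
  smul_continuousl : forall a : X, continuous (smul^~ a)
}.

#[short(type="semitopologicalSemilatticeType")]
HB.structure Definition SemitopologicalSemilattice :=
  { X of Topological X & isSemitopologicalSemilattice X }.

Section Definitions.
Context (X : semitopologicalSemilatticeType).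
Implicit Types (x y : X) (A F V : set X).

Definition sle x y := smul x y = x.

Definition upset x : set X := [set y | sle x y].
Definition downset x : set X := [set y | sle y x].
Definition upset_of F : set X := \bigcup_(y in F) upset y.

Definition subsemilattice A := forall x y, A x -> A y -> A (smul x y).

(* [set_type] carries the subspace topology. *)
Local Notation II R := (set_type `[0%R : R, 1%R]).

Definition Ihom (R : realType) (h : X -> II R) : Prop :=
  continuous h /\
  forall x y, set_val (h (smul x y)) =
              Order.min (set_val (h x)) (set_val (h y)).

Definition weako_base : set (set X) :=
  [set V | open V /\ subsemilattice V].

Definition weakb_subbase : set (set X) :=
  [set ~` A | A in [set A | closed A /\ subsemilattice A]].

Definition Iweak_subbase (R : realType) : set (set X) :=
  [set V | exists2 h : X -> II R, Ihom h &
             exists2 U : set (II R), open U & V = h @^-1` U].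

Lemma weako_base_cover : \bigcup_(V in weako_base) id V = setT.
Proof. by rewrite -subTset => x _; exists setT => //; split => //; exact: openT. Qed.

Lemma weako_base_join A V x : weako_base A -> weako_base V -> A x -> V x ->
  exists k, [/\ weako_base k, k x & k `<=` A `&` V].
Proof.
move=> [oA sA] [oV sV] Ax Vx; exists (A `&` V); split => //.
split; first exact: openI.
by move=> y z [Ay Vy] [Az Vz]; split; [exact: sA|exact: sV].
Qed.

(* Aliases of X carrying the three topologies, to be used as [open (T := _)]
   and [hausdorff_space _]. *)
Definition weako : Type := X.
Definition weakb : Type := X.
Definition Iweak (R : realType) : Type := X.

HB.instance Definition _ := Choice.on weako.
HB.instance Definition _ :=
  isBaseTopological.Build weako weako_base_cover weako_base_join.

HB.instance Definition _ := Choice.on weakb.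
HB.instance Definition _ := isSubBaseTopological.Build weakb weakb_subbase id.

HB.instance Definition _ R := Choice.on (Iweak R).
HB.instance Definition _ R :=
  isSubBaseTopological.Build (Iweak R) (Iweak_subbase R) id.

Definition weako_separated := forall x y, x <> y ->
  exists Ox Oy : set X, [/\ open (Ox : set weako), open Oy,
                            Ox x, Oy y & Ox `&` Oy = set0].

Definition weakb_separated := forall x y, x <> y ->
  exists Ox Oy : set X, [/\ open (Ox : set weakb), open Oy,
                            Ox x, Oy y & Ox `&` Oy = set0].

Definition I_separated (R : realType) := forall x y, x <> y ->
  exists2 h : X -> II R, Ihom h & h x <> h y.

Definition U_semilattice := forall V x, open V -> V x ->
  exists2 v, V v & interior (upset v) x.

Definition W_semilattice := forall V x, open V -> V x ->
  exists F, [/\ finite_set F, F `<=` V & interior (upset_of F) x].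

Definition V_semilattice := forall x y, ~ sle x y ->
  exists2 v, ~ downset y v & interior (upset v) x.

End Definitions.

(* Main.v *)
Require Import Defs.
From mathcomp Require Import all_boot all_order all_algebra finmap.
From mathcomp Require Import all_classical reals topology normedtype lra.
Import Order.TTheory GRing.Theory Num.Theory.
Import numFieldNormedType.Exports.

Set Implicit Arguments.
Unset Strict Implicit.
Unset Printing Implicit Defensive.

Local Open Scope classical_set_scope.

(** Everything is reduced to the property of being a [U_semilattice]. Write
    [v << x] when [x] is interior to [upset v].

    In a compact Hausdorff semitopological semilattice the principal up- and
    down-sets are closed, so compactness provides a least element of every
    nonempty closed subsemilattice, and a supremum, lying in the closure, of
    every directed set. Hence the set of all [v << x] is directed: the least
    element of [upset a `&` upset b] is a join of [a] and [b]. It has a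
    supremum [s] below [x], and [X] is a [U_semilattice] as soon as [s = x] for
    all [x] ([U_semilattice_sup]). The [V] property gives [s = x] immediately.

    A [W_semilattice] is a [U_semilattice] by separate continuity: if [x] is
    interior to a finite union of sets [upset f], it is interior to one of them
    ([interior_upset_of]).

    Both separation properties yield, for [s <> x], finitely many closed
    subsemilattices that miss [s] and cover a neighbourhood of [x]; for the
    topology generated by open subsemilattices, the closure of one such set is
    enough. If [s] is the supremum of the [v << x], the preceding fact shows
    that one of these subsemilattices contains cofinally many [v << x], hence
    contains [s], a contradiction; so [s = x] ([separated_U]).

    Conversely, in a [U_semilattice] the relation [<<] interpolates. As in
    Urysohn's lemma, when [~ sle x y], inserting points at the dyadic rationals
    between some [v << x] with [~ sle v y] and [x] yields a scale, and mapping
    [z] to the supremum of the indices of the scale points below [z] is a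
    continuous homomorphism to the unit interval separating [x] from [y]
    ([U_semilattice_I_separated]): the map preserves [min] because the indices
    of the scale points below [z] form an initial segment. So the topology
    generated by the continuous homomorphisms is Hausdorff, and being coarser
    than a compact topology it coincides with it. The two other weak
    topologies lie in between, since every subset of a chain is a
    subsemilattice. *)

(** * Topologies generated by a subbase *)

Section Subbase.
Context (T : choiceType) (S : set (set T)).

(** This form is convertible to the open sets of a topology built from the
    subbase [S]. *)
Definition subbase_open : set (set T) :=
  [set \bigcup_(V in D) id V | D in subset^~ (finI_from S id)].

Lemma subbase_openP (O : set T) x : subbase_open O -> O x ->
  exists2 D : seq (set T), {in D, forall B, S B} &
    (forall B, B \in D -> B x) /\
    (forall y, (forall B, B \in D -> B y) -> O y).
Proof.
move=> [C CS <-] [V CV Vx]; have [D DS DV] := CS V CV.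
exists (enum_fset D) => [B /DS/set_mem//|]; split=> [B BD|y Dy].
  by move: Vx; rewrite -DV; exact.
by exists V => //; rewrite -DV => B; exact: Dy.
Qed.

Lemma subbase_open_sub (B : set T) : S B -> subbase_open B.
Proof.
move=> SB; exists [set B]; last by rewrite bigcup_set1.
by move=> _ ->; exact: finI_from1.
Qed.

End Subbase.

(** * The order of a semitopological semilattice *)

Section Order.
Context (X : semitopologicalSemilatticeType).
Implicit Types (x y z v s : X) (A D V G : set X).

Lemma slexx x : sle x x. Proof. exact: smulxx. Qed.

Lemma sle_trans y x z : sle x y -> sle y z -> sle x z.
Proof. by rewrite /sle => xy yz; rewrite -[in LHS]xy -smulA yz. Qed.

Lemma sle_anti x y : sle x y -> sle y x -> x = y.
Proof. by rewrite /sle => xy yx; rewrite -xy -[RHS]yx smulC. Qed.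

Lemma smul_lel x y : sle (smul x y) x.
Proof. by rewrite /sle smulC smulA smulxx. Qed.

Lemma smul_ler x y : sle (smul x y) y.
Proof. by rewrite smulC; exact: smul_lel. Qed.

Lemma sle_smul z x y : sle z x -> sle z y -> sle z (smul x y).
Proof. by rewrite /sle smulA => -> ->. Qed.

Lemma subsemilattice_upset x : subsemilattice (upset x).
Proof. by move=> y z; exact: sle_smul. Qed.

Lemma subsemilatticeI A B :
  subsemilattice A -> subsemilattice B -> subsemilattice (A `&` B).
Proof.
by move=> sA sB y z [Ay By] [Az Bz]; split; [exact: sA|exact: sB].
Qed.

Lemma nbhs_smulr x y A : nbhs (smul x y) A -> nbhs y (smul x @^-1` A).
Proof. exact: smul_continuousr. Qed.

Lemma nbhs_smull x y A : nbhs (smul x y) A -> nbhs x (smul^~ y @^-1` A).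
Proof. exact: smul_continuousl. Qed.

(** The closure absorbs one factor at a time. *)
Lemma subsemilattice_closure A : subsemilattice A -> subsemilattice (closure A).
Proof.
move=> sA.
have half a y : A a -> closure A y -> closure A (smul a y).
  move=> Aa cy B /nbhs_smulr /cy[b [Ab Bb]].
  by exists (smul a b); split => //; exact: sA.
move=> x y cx cy; apply: closed_closure.
move=> B /nbhs_smull /cx[a [Aa Ba]].
by exists (smul a y); split => //; exact: half.
Qed.

(** As [smul x y = x], multiplication by [x] pulls the neighbourhood [upset v] of
    [x] back to a neighbourhood of [y], whose points are above [v] too. *)
Lemma interior_upset_le v x y :
  interior (upset v) x -> sle x y -> interior (upset v) y.
Proof.
move=> vx xy; have : nbhs (smul x y) (upset v) by rewrite xy.
move=> /nbhs_smulr Ny; apply: filterS Ny => z vz.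
exact: sle_trans vz (smul_ler x z).
Qed.

(** If [x] were interior to no [upset f], then points [d_f] outside [upset f]
    could be picked one after the other, each so close to [x] that the product
    of those picked so far stays in [G]; the total product then lies in [G] and
    above no [f]. *)
Lemma avoid_upsets (F : seq X) G x : open G -> G x ->
  (forall f, f \in F -> ~ interior (upset f) x) ->
  exists p, [/\ G p, sle p x & forall f, f \in F -> ~ sle f p].
Proof.
move=> oG Gx; elim: F => [_|f F IH nF]; first by exists x; split=> //; exact: slexx.
have [g gF|p [Gp px pF]] := IH; first by apply: nF; rewrite inE gF orbT.
have /nbhs_smulr Np : nbhs (smul p x) G.
  by rewrite px; exact: open_nbhs_nbhs.
have [d [Gd fd]] : exists d, G (smul p d) /\ ~ sle f d.
  apply: contrapT => nd; apply: (nF f); first by rewrite inE eqxx.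
  by apply: filterS Np => d Gd; apply: contrapT => fd; apply: nd; exists d.
exists (smul p d); split=> //.
  exact: sle_trans (smul_lel _ _) px.
move=> g; rewrite inE => /predU1P[->|gF] gle.
  by apply: fd; apply: sle_trans gle (smul_ler _ _).
by apply: (pF g) => //; apply: sle_trans gle (smul_lel _ _).
Qed.

Lemma interior_upset_of (F : set X) x : finite_set F ->
  interior (upset_of F) x -> exists2 f, F f & interior (upset f) x.
Proof.
move=> /finite_seqP[s ->] Fx; apply: contrapT => nF.
have [||f fs fx|p [Gp _ ps]] :=
  @avoid_upsets s (interior (upset_of [set` s])) x.
- exact: open_interior.
- exact: Fx.
- by apply: nF; exists f.
- by have [f fs] := interior_subset Gp; exact: ps.
Qed.

Lemma W_semilattice_U : W_semilattice X -> U_semilattice X.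
Proof.
move=> WX V x oV Vx; have [F [finF FV Fx]] := WX V x oV Vx.
by have [f Ff fx] := interior_upset_of finF Fx; exists f => //; exact: FV.
Qed.

Lemma U_semilattice_W : U_semilattice X -> W_semilattice X.
Proof.
move=> UX V x oV Vx; have [v Vv vx] := UX V x oV Vx.
exists [set v]; split; [exact: finite_set1|by move=> _ ->|].
by apply: filterS vx => y vy; exists v.
Qed.

(** If no element of [D `&` A] lies above [d0], then above [d0], hence everywhere
    by directedness, [A] can be dropped from the list. *)
Lemma cofinal_pigeonhole D (L : seq (set X)) :
  (forall a b, D a -> D b -> exists c, [/\ D c, sle a c & sle b c]) ->
  (exists d, D d) ->
  (forall d, D d -> exists2 A, A \in L & exists2 b, (D `&` A) b & sle d b) ->
  exists2 A, A \in L &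
    forall d, D d -> exists2 b, (D `&` A) b & sle d b.
Proof.
move=> dirD [e De]; elim: L => [/(_ e De)[//]|A L IH cofL].
have [cofA|] := pselect (forall d, D d -> exists2 b, (D `&` A) b & sle d b).
  by exists A => //; rewrite inE eqxx.
move=> /existsNP[d0] /not_implyP[Dd0 nA].
have [|B BL cofB] := IH; last by exists B => //; rewrite inE BL orbT.
move=> d Dd; have [c [Dc dc d0c]] := dirD d d0 Dd Dd0.
have [B + [b DBb cb]] := cofL c Dc; rewrite inE => /predU1P[BA|BL].
  by case: nA; exists b; [rewrite -BA|exact: sle_trans cb].
by exists B => //; exists b => //; exact: sle_trans cb.
Qed.

Definition is_sup D s :=
  (forall d, D d -> sle d s) /\
  (forall u, (forall d, D d -> sle d u) -> sle s u).

Lemma is_sup_cofinal D E s t : E `<=` D ->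
  (forall d, D d -> exists2 e, E e & sle d e) ->
  is_sup D s -> is_sup E t -> s = t.
Proof.
move=> ED cofE [Ds sD] [Et tE]; apply: sle_anti.
  by apply: sD => d /cofE[e Ee de]; apply: sle_trans de _; exact: Et.
by apply: tE => e /ED; exact: Ds.
Qed.

End Order.

(** * Suprema and infima in compact semilattices *)

Section Compact.
Context (X : semitopologicalSemilatticeType).
Hypotheses (X_compact : compact [set: X]) (X_hausdorff : hausdorff_space X).
Implicit Types (x y z v s : X) (A D V G : set X).

Lemma closed_upset x : closed (upset x).
Proof.
have -> : upset x = smul x @^-1` [set x] by [].
apply: preimage_closed => [y _|]; first exact: smul_continuousr.
exact/accessible_closed_set1/hausdorff_accessible.
Qed.

Lemma closed_downset x : closed (downset x).
Proof.
move=> y cy; apply: X_hausdorff => B C /nbhs_smull NB NC.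
have [z [zx [Bz Cz]]] := cy _ (filterI NB NC).
by exists z; split => //; rewrite -zx.
Qed.

Lemma directed_closed_bigcap (I : Type) (P : set I) (C : I -> set X) :
  (exists i, P i) -> (forall i, P i -> closed (C i)) ->
  (forall i, P i -> C i !=set0) ->
  (forall i j, P i -> P j -> exists2 k, P k & C k `<=` C i `&` C j) ->
  exists p, forall i, P i -> C i p.
Proof.
move=> P0 clC C0 dirC.
have FF := filter_from_filter P0 dirC.
have PF := filter_from_proper FF C0.
have [|p [_ cp]] := X_compact PF; first exact: filterT.
exists p => i Pi; apply: (clC i Pi) => B NB.
by apply: cp => //; exists i.
Qed.

(** The infimum is a point common to the closed sets [A `&` downset a]. *)
Lemma closed_subsemilattice_min A : closed A -> subsemilattice A -> A !=set0 ->
  exists2 m, A m & forall a, A a -> sle m a.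
Proof.
move=> clA sA [a0 Aa0].
have [||a Aa|a b Aa Ab|m mA] := @directed_closed_bigcap X A
    (fun a => A `&` downset a).
- by exists a0.
- by move=> a Aa; apply: closedI => //; exact: closed_downset.
- by exists a; split => //; exact: slexx.
- exists (smul a b); first exact: sA.
  move=> c [Ac cab]; split; split => //; apply: sle_trans cab _.
    exact: smul_lel.
  exact: smul_ler.
by exists m; [case: (mA _ Aa0)|move=> a /mA[]].
Qed.

(** The supremum is a point common to the closed sets
    [closure D `&` upset d]. *)
Lemma directed_sup D : (exists d, D d) ->
  (forall a b, D a -> D b -> exists c, [/\ D c, sle a c & sle b c]) ->
  exists2 s, closure D s & is_sup D s.
Proof.
move=> D0 dirD.
have [||d Dd|a b Da Db|s sD] := @directed_closed_bigcap X D
    (fun d => closure D `&` upset d).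
- exact: D0.
- move=> d Dd; apply: closedI; first exact: closed_closure.
  exact: closed_upset.
- by exists d; split; [exact: subset_closure|exact: slexx].
- have [c [Dc ac bc]] := dirD a b Da Db; exists c => // e [cDe ce].
  by split; split=> //; [exact: sle_trans ac _|exact: sle_trans bc _].
have [d0 Dd0] := D0; have [cs _] := sD _ Dd0.
exists s => //; split=> [d /sD[]//|u uD].
have : closure (downset u) s by apply: closure_subset cs => d; exact: uD.
exact: closed_downset.
Qed.

(** The analogue of the way-below set of [x] in a continuous lattice, with the
    given topology in place of the Scott topology. *)
Definition approximants x : set X := [set v | interior (upset v) x].

Lemma approximants_le x v : approximants x v -> sle v x.
Proof. exact: interior_subset. Qed.

(** The least element of [upset a `&` upset b] is a join of [a] and [b], so its
    upper set is this intersection. *)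
Lemma approximants_dir x a b : approximants x a -> approximants x b ->
  exists c, [/\ approximants x c, sle a c & sle b c].
Proof.
move=> ax bx; have abx : nbhs x (upset a `&` upset b) by exact: filterI.
have [|||c [ac bc] cmin] := @closed_subsemilattice_min (upset a `&` upset b).
- by apply: closedI; exact: closed_upset.
- by apply: subsemilatticeI; exact: subsemilattice_upset.
- by exists x; exact: nbhs_singleton abx.
by exists c; split => //; apply: filterS abx.
Qed.

Lemma approximants_neq0 x : exists v, approximants x v.
Proof.
have [|//||m _ mle] := @closed_subsemilattice_min [set: X].
- exact: closedT.
- by exists x.
by exists m; apply: (filterS _ (@filterT _ (nbhs x) _)) => y _; exact: mle.
Qed.

Lemma approximants_sup x :
  exists2 s, closure (approximants x) s & is_sup (approximants x) s.
Proof.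
apply: directed_sup; first exact: approximants_neq0.
by move=> a b; exact: approximants_dir.
Qed.

Lemma U_semilattice_sup :
  (forall x s, is_sup (approximants x) s -> s = x) -> U_semilattice X.
Proof.
move=> supX V x oV Vx; have [s cs /supX sx] := approximants_sup x.
have [v [vx Vv]] : approximants x `&` V !=set0.
  by apply: cs; rewrite sx; exact: open_nbhs_nbhs.
by exists v.
Qed.

Lemma V_semilattice_U : V_semilattice X -> U_semilattice X.
Proof.
move=> VX; apply: U_semilattice_sup => x s [ub lub].
apply: sle_anti; first by apply: lub => d; exact: approximants_le.
by apply: contrapT => /VX[v nvs vx]; apply: nvs; exact: ub.
Qed.

Lemma U_semilattice_V : U_semilattice X -> V_semilattice X.
Proof.
move=> UX x y nxy.
have [||v] := UX (~` downset y) x; last by exists v.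
- exact/closed_openC/closed_downset.
- exact: nxy.
Qed.

(** * From separation to approximation *)

(** The common consequence of both separation properties. *)
Definition separated_by_closed_subsemilattices := forall s x, s <> x ->
  exists2 L : seq (set X),
    forall A, A \in L -> [/\ closed A, subsemilattice A & ~ A s] &
    interior (\bigcup_(A in [set` L]) A) x.

(** Suppose that the supremum [s] of the approximants of [x] differs from [x],
    and let closed subsemilattices [A_i] missing [s] cover a neighbourhood of
    [x]. For an approximant [d], the least elements of the [A_i `&` upset d]
    form a finite set whose upper set is a neighbourhood of [x], so one of them
    is an approximant. Some [A_i] thus contains cofinally many approximants, and
    being closed it contains their supremum [s]. *)
Lemma separated_U : separated_by_closed_subsemilattices -> U_semilattice X.
Proof.
move=> sepX; apply: U_semilattice_sup => x s sup_s; apply: contrapT => nsx.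
have [L clL Lx] := sepX s x nsx.
have [||d dx|A AL cofA] := @cofinal_pigeonhole X (approximants x) L.
- by move=> a b; exact: approximants_dir.
- exact: approximants_neq0.
- have minA A : exists m, A \in L -> A `&` upset d !=set0 ->
      (A `&` upset d) m /\ forall a, (A `&` upset d) a -> sle m a.
    have [AL|nAL] := pselect (A \in L); last by exists x.
    have [Ad0|nAd0] := pselect (A `&` upset d !=set0); last by exists x.
    have [clA sA _] := clL A AL.
    have [|||m Am mle] := @closed_subsemilattice_min (A `&` upset d).
    + by apply: closedI => //; exact: closed_upset.
    + by apply: subsemilatticeI => //; exact: subsemilattice_upset.
    + exact: Ad0.
    by exists m.
  have /choice[m mP] := minA.
  pose F := [set m A | A in [set A | A \in L /\ A `&` upset d !=set0]].
  have finF : finite_set F.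
    apply: finite_image; apply: (@sub_finite_set _ _ [set` L]); last first.
      exact: finite_seq.
    by move=> A [].
  have Fx : interior (upset_of F) x.
    apply: filterS (filterI Lx dx) => y [[A AL Ay] dy].
    have Ad0 : A `&` upset d !=set0 by exists y.
    by exists (m A); [exists A|apply: (mP A AL Ad0).2].
  have [_ [A [AL Ad0] <-] mx] := interior_upset_of finF Fx.
  have [[Am dm] _] := mP A AL Ad0.
  by exists A => //; exists (m A).
have [||t cEt sup_t] := @directed_sup (approximants x `&` A).
- have [d dx] := approximants_neq0 x.
  by have [b ? _] := cofA d dx; exists b.
- move=> a b [ax _] [bx _]; have [c [cx ac bc]] := approximants_dir ax bx.
  have [e Ee ce] := cofA c cx; exists e; split => //; exact: sle_trans ce.
have [clA _ nAs] := clL A AL; apply: nAs.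
rewrite (is_sup_cofinal _ cofA sup_s sup_t); last by move=> ? [].
by apply: clA; apply: closure_subset cEt => ? [].
Qed.

(** Here the weak neighbourhood is taken around [x], and the closure of a basic
    one covers it. *)
Lemma weako_separated_closed :
  weako_separated X -> separated_by_closed_subsemilattices.
Proof.
move=> sepX s x sx.
have [O [G [+ oG Ox Gs OG0]]] := sepX x s (nesym sx).
rewrite /open /= => -[D Dbase defO].
have [V DV Vx] : (\bigcup_(V in D) id V) x by rewrite defO.
have [oV sV] := Dbase V DV.
exists [:: closure V] => [A|].
  rewrite inE => /eqP->; split; first exact: closed_closure.
    exact: subsemilattice_closure.
  move=> /(_ G (open_nbhs_nbhs (conj oG Gs)))[z [Vz Gz]].
  have : (O `&` G) z by split => //; rewrite -defO; exists V.
  by rewrite OG0.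
apply: (@filterS _ _ _ V) => [y Vy|]; last exact: open_nbhs_nbhs.
by exists (closure V); [rewrite /= inE|exact: subset_closure].
Qed.

(** Here the weak neighbourhood is taken around [s]: the complements of the
    subbasic sets around [s] cover any set disjoint from their intersection. *)
Lemma weakb_separated_closed :
  weakb_separated X -> separated_by_closed_subsemilattices.
Proof.
move=> sepX s x sx.
have [O [G [oO oG Os Gx OG0]]] := sepX s x sx.
have [D DS [Ds DO]] := subbase_openP oO Os.
exists [seq ~` B | B <- D] => [A /mapP[B BD ->]|].
  have [C [clC sC] CB] := DS B BD; split; rewrite -CB ?setCK //.
  by move=> Cs; have := Ds B BD; rewrite -CB.
apply: (@filterS _ _ _ G) => [y Gy|]; last exact: open_nbhs_nbhs.
apply: contrapT => nAy.
have Oy : O y.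
  apply: DO => B BD; apply: contrapT => nBy; apply: nAy.
  by exists (~` B) => //=; exact: map_f.
by have : (O `&` G) y by []; rewrite OG0.
Qed.

End Compact.

(** * Comparison of the topologies *)

(** Images of closed sets are compact, hence closed. *)
Lemma compact_hausdorff_homeo (T U : topologicalType) (f : T -> U) (g : U -> T) :
  compact [set: T] -> hausdorff_space U -> continuous f ->
  cancel f g -> cancel g f -> continuous g.
Proof.
move=> cT hU cf fK gK; apply/continuousP => A oA.
have -> : g @^-1` A = ~` (f @` ~` A).
  rewrite eqEsubset; split=> [u Agu [t nAt fu]|u nu].
    by apply: nAt; rewrite -[t]fK fu.
  by apply: contrapT => nAgu; apply: nu; exists (g u).
apply: closed_openC; apply: compact_closed => //.
apply: continuous_compact; first exact: continuous_subspaceT.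
by apply: subclosed_compact cT _ => //; exact: open_closedC.
Qed.

Lemma hausdorff_continuous_inj (T U : topologicalType) (f : T -> U) :
  hausdorff_space U -> continuous f -> injective f -> hausdorff_space T.
Proof.
move=> hU cf injf x y xy; apply: injf; apply: hU => A B Afx Bfy.
by have [z [Az Bz]] := xy _ _ (cf x A Afx) (cf y B Bfy); exists (f z).
Qed.

Lemma subbase_open_le (T : topologicalType) (S : set (set T)) :
  S `<=` open -> subbase_open S `<=` open.
Proof.
move=> So O [C CS <-]; apply: bigcup_open => V CV.
have [D DS <-] := CS V CV; rewrite openE => x Dx.
apply: filter_bigI => B BD; apply: open_nbhs_nbhs; split.
  exact/So/set_mem/DS.
exact: Dx.
Qed.

Section Comparison.
Context (R : realType) (X : semitopologicalSemilatticeType).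

Lemma weako_open_sub :
  (open : set_system (weako X)) `<=` (open : set_system X).
Proof. by move=> A [D Dbase <-]; apply: bigcup_open => V /Dbase[]. Qed.

Lemma weakb_open_sub :
  (open : set_system (weakb X)) `<=` (open : set_system X).
Proof.
apply: (@subbase_open_le X (@weakb_subbase X)) => _ [A [clA _] <-].
exact: closed_openC.
Qed.

Local Notation II := (set_type `[0%R : R, 1%R]).

(** In a chain the product of two elements is one of them, so that every subset
    of the unit interval is a subsemilattice. *)
Lemma Ihom_subsemilattice (h : X -> II) (U : set II) :
  Ihom h -> subsemilattice (h @^-1` U).
Proof.
move=> [_ hM] x y /= Ux Uy; have := hM x y.
by case: leP => _ /val_inj ->.
Qed.

Lemma Iweak_weako_open_sub :
  (open : set_system (Iweak X R)) `<=` (open : set_system (weako X)).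
Proof.
apply: (@subbase_open_le (weako X) (@Iweak_subbase X R)) => _ [h hh [U oU ->]].
exists [set h @^-1` U]; last by rewrite bigcup_set1.
move=> _ ->; split; last exact: Ihom_subsemilattice.
by have [/continuousP ch _] := hh; exact: ch.
Qed.

Lemma Iweak_weakb_open_sub :
  (open : set_system (Iweak X R)) `<=` (open : set_system (weakb X)).
Proof.
apply: (@subbase_open_le (weakb X) (@Iweak_subbase X R)) => _ [h hh [U oU ->]].
apply: subbase_open_sub; exists (h @^-1` (~` U)); last first.
  by rewrite preimage_setC setCK.
split; last exact: Ihom_subsemilattice.
rewrite preimage_setC; apply: open_closedC.
by have [/continuousP ch _] := hh; exact: ch.
Qed.

Lemma Iweak_open_sub :
  (open : set_system (Iweak X R)) `<=` (open : set_system X).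
Proof. by apply: subset_trans weako_open_sub; exact: Iweak_weako_open_sub. Qed.

Lemma I_separated_hausdorff : I_separated X R -> hausdorff_space (Iweak X R).
Proof.
move=> sepX; rewrite open_hausdorff => x y /eqP /sepX[h hh hxy].
have hII : hausdorff_space II.
  apply: (@hausdorff_continuous_inj _ _ (set_val : II -> R)) => [||a b /val_inj//].
    exact: Rhausdorff.
  exact: initial_continuous.
move/eqP: hxy; rewrite open_hausdorff in hII => /hII[[A B] /= [Ax By] [oA oB AB0]].
have oh U : open U -> open (h @^-1` U : set (Iweak X R)).
  by move=> oU; apply: subbase_open_sub; exists h => //; exists U.
exists (h @^-1` A, h @^-1` B) => /=.
  by rewrite !inE /= in Ax By *.
split; [exact: oh|exact: oh|].
by rewrite -preimage_setI (eqP AB0) preimage_set0.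
Qed.

Lemma hausdorff_separated (T : topologicalType) : hausdorff_space T ->
  forall x y : T, x <> y ->
  exists Ox Oy : set T, [/\ open Ox, open Oy, Ox x, Oy y & Ox `&` Oy = set0].
Proof.
rewrite open_hausdorff => hT x y /eqP/hT[[A B] /= [/set_mem Ax /set_mem By]].
by move=> [oA oB /eqP AB0]; exists A, B.
Qed.

Lemma hausdorff_weako_separated : hausdorff_space (weako X) -> weako_separated X.
Proof.
move=> hX x y /(hausdorff_separated hX)[A [B [oA oB Ax By AB0]]].
by exists A, B; split => //; exact: weako_open_sub.
Qed.

Lemma hausdorff_weakb_separated : hausdorff_space (weakb X) -> weakb_separated X.
Proof.
move=> hX x y /(hausdorff_separated hX)[A [B [oA oB Ax By AB0]]].
by exists A, B; split => //; exact: weakb_open_sub.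
Qed.

Lemma Iweak_hausdorff_weako :
  hausdorff_space (Iweak X R) -> hausdorff_space (weako X).
Proof.
move=> hX; apply: (@hausdorff_continuous_inj (weako X) (Iweak X R) id) => //.
by apply/continuousP => A; exact: Iweak_weako_open_sub.
Qed.

Lemma Iweak_open_eq : compact [set: X] -> hausdorff_space (Iweak X R) ->
  (open : set_system (Iweak X R)) = (open : set_system X).
Proof.
move=> cX hX; apply/seteqP; split; first exact: Iweak_open_sub.
have /continuousP : continuous (id : Iweak X R -> X).
  apply: (@compact_hausdorff_homeo X (Iweak X R) id) => //.
  by apply/continuousP => A; exact: Iweak_open_sub.
exact.
Qed.

End Comparison.

(** * A Urysohn construction *)

(** Indices of dyadic rationals: level [n] holds the multiples of [1 / 2 ^ n],
    and passing to level [n.+1] inserts midpoints by means of [mid]. *)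
Fixpoint dyadic (T : Type) (mid : T -> T -> T) (v w : T) (n k : nat) : T :=
  match n with
  | 0 => if k == 0 then v else w
  | n.+1 => let a := dyadic mid v w n k./2 in
            if odd k then mid a (dyadic mid v w n k./2.+1) else a
  end.

(** Neither the index [k / 2 ^ n] nor the value depends on the level at which it
    is computed. *)
Lemma dyadic_expand (T : Type) (mid : T -> T -> T) v w n m k :
  dyadic mid v w (m + n) (2 ^ m * k) = dyadic mid v w n k.
Proof.
elim: m => [|m IH]; first by rewrite mul1n.
by rewrite addSn /= expnS -mulnA mul2n odd_double doubleK.
Qed.

(** The bound on [j] matters: level [0] is constant from index [1] on. *)
Lemma dyadic_lt (T : Type) (lt : T -> T -> Prop) (mid : T -> T -> T) v w n i j :
  (forall a b c, lt a b -> lt b c -> lt a c) ->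
  (forall a b, lt a b -> lt a (mid a b) /\ lt (mid a b) b) ->
  lt v w -> (i < j <= 2 ^ n)%N ->
  lt (dyadic mid v w n i) (dyadic mid v w n j).
Proof.
move=> lt_trans lt_mid vw; have step : forall k, (k < 2 ^ n)%N ->
    lt (dyadic mid v w n k) (dyadic mid v w n k.+1).
  elim: n => [[|//]//|n IH] k kn /=.
  have : (k./2 < 2 ^ n)%N by rewrite ltn_half_double -mul2n -expnS.
  move=> /IH/lt_mid[]; rewrite uphalf_half.
  by case: (odd k).
elim: j => // j IH /andP[]; rewrite ltnS leq_eqVlt => /predU1P[->|ij] jn.
  exact: step.
by apply: lt_trans (step j jn); apply: IH; rewrite ij ltnW.
Qed.

Section Urysohn.
Context (R : realType).
Local Open Scope ring_scope.

Definition dyadic_graph (T : Type) (mid : T -> T -> T) v w : set (R * T) :=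
  [set p | exists n k, [/\ (k <= 2 ^ n)%N, p.1 = k%:R / 2 ^+ n &
                           p.2 = dyadic mid v w n k]].

Lemma dyadic_dense (a b : R) : 0 <= a -> a < b -> b <= 1 ->
  exists n k, (k <= 2 ^ n)%N /\ a < k%:R / 2 ^+ n < b.
Proof.
move=> a0 ab b1.
pose N := (Num.truncn (b - a)^-1).+1.
have ba0 : 0 < (b - a)^-1 by rewrite invr_gt0 subr_gt0.
have N2 : (b - a)^-1 < 2 ^+ N.
  apply: (@lt_trans _ _ N%:R); last by rewrite -natrX ltr_nat ltn_expl.
  by have /andP[] := Num.Theory.truncn_itv (ltW ba0).
pose k := (Num.truncn (a * 2 ^+ N)).+1.
have p0 : 0 < 2 ^+ N :> R by rewrite exprn_gt0.
have /andP[k1 k2] := Num.Theory.truncn_itv (mulr_ge0 a0 (ltW p0)).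
have ak : a < k%:R / 2 ^+ N by rewrite ltr_pdivlMr.
have kb : k%:R / 2 ^+ N < b.
  rewrite ltr_pdivrMr // /k -[X in X < _]natr1.
  have : 1 < (b - a) * 2 ^+ N.
    by rewrite -ltr_pdivrMl ?subr_gt0 // mulr1.
  by rewrite mulrBl; lra.
exists N, k; split; last by rewrite ak kb.
rewrite -(ler_nat R) natrX -[leRHS]mul1r -ler_pdivrMr //.
exact: le_trans (ltW kb) b1.
Qed.

Context (X : semitopologicalSemilatticeType).
Implicit Types (x y z v w : X) (E : set (R * X)).

(** The graph of a multivalued map from a dense subset of the unit interval to
    [X] under which larger indices have values approximated by those of smaller
    ones. *)
Definition interpolating_scale E :=
  [/\ forall p, E p -> 0 <= p.1 <= 1,
      forall a b, 0 <= a -> a < b -> b <= 1 ->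
        exists2 p, E p & a < p.1 < b &
      forall p q, E p -> E q -> p.1 < q.1 -> approximants q.2 p.2].

Lemma U_semilattice_scale v w : U_semilattice X -> approximants w v ->
  exists2 E, interpolating_scale E & E (0, v) /\ E (1, w).
Proof.
move=> UX vw.
have /choice[mid' mid'P] (p : X * X) : exists u, approximants p.2 p.1 ->
    approximants u p.1 /\ approximants p.2 u.
  have [p12|np] := pselect (approximants p.2 p.1); last by exists v.
  have [u p1u up2] := UX _ _ (@open_interior _ (upset p.1)) p12.
  by exists u.
pose mid a b := mid' (a, b).
have approx_trans (a b c : X) : approximants b a -> approximants c b -> approximants c a.
  by move=> ab /approximants_le; exact: interior_upset_le.
have approx_mid a b : approximants b a ->
    approximants (mid a b) a /\ approximants b (mid a b).
  exact: (mid'P (a, b)).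
exists (dyadic_graph mid v w); last first.
  by split; [exists 0, 0|exists 0, 1]; rewrite ?mul0r //= expr0 divr1.
split=> [p [n [k [kn -> _]]]|a b a0 ab b1|p q].
- rewrite divr_ge0 ?exprn_ge0 // ler_pdivrMr ?exprn_gt0 // mul1r.
  by rewrite -natrX ler_nat.
- have [n [k [kn akb]]] := dyadic_dense a0 ab b1.
  by exists (k%:R / 2 ^+ n, dyadic mid v w n k) => //; exists n, k.
move=> [n [k [kn -> ->]]] [m [l [lm -> ->]]].
rewrite ltr_pdivrMr ?exprn_gt0 // mulrAC ltr_pdivlMr ?exprn_gt0 //.
rewrite -!natrX -!natrM ltr_nat => kl.
rewrite -(dyadic_expand mid v w n m k) -(dyadic_expand mid v w m n l).
rewrite [(n + m)%N]addnC.
apply: (@dyadic_lt _ (fun a b => approximants b a)) => //.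
by rewrite mulnC [(2 ^ n * l)%N]mulnC kl /= expnD leq_mul2r lm orbT.
Qed.

Section Scale.
Context (E : set (R * X)).
Hypotheses (closed_up : forall x, closed (upset x)) (scaleE : interpolating_scale E).

(* The element 0 makes the set nonempty when no scale point is below [z]. *)
Let lower z : set R := [set t | t = 0 \/ exists2 v, E (t, v) & sle v z].

Definition scale_val z := sup (lower z).

Let lower_has_sup z : has_sup (lower z).
Proof.
split; first by exists 0; left.
exists 1 => t [->//|[v Etv _]].
by have [/(_ _ Etv)/andP[]] := scaleE.
Qed.

Lemma scale_val_ge p z : E p -> sle p.2 z -> p.1 <= scale_val z.
Proof.
case: p => t v Ep vz; apply: sup_upper_bound; first exact: lower_has_sup.
by right; exists v.
Qed.

(** Approximation, and not merely order, is obtained because [p.1] is exceeded by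
    the index of another scale point below [z]. *)
Lemma scale_val_lt p z : E p -> p.1 < scale_val z -> approximants z p.2.
Proof.
have [E01 _ Elt] := scaleE => Ep.
rewrite -subr_gt0 => /sup_adherent/(_ (lower_has_sup z))[t].
rewrite opprB addrCA subrr addr0 => -[-> p0|[v Etv vz] pt].
  by have := E01 p Ep; rewrite leNgt p0.
exact: interior_upset_le (Elt _ _ Ep Etv pt) vz.
Qed.

Lemma scale_val_itv z : 0 <= scale_val z <= 1.
Proof.
apply/andP; split.
  by apply: sup_upper_bound; [exact: lower_has_sup|left].
apply: ge_sup; first by exists 0; left.
move=> t [->//|[v Etv _]]; by have [/(_ _ Etv)/andP[]] := scaleE.
Qed.

Lemma scale_val_le x y : sle x y -> scale_val x <= scale_val y.
Proof.
move=> xy; apply: le_sup; [|by exists 0; left|exact: lower_has_sup].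
move=> t lt; exists t; split => //.
by case: lt => [->|[v Ev vx]]; [left|right; exists v => //; exact: sle_trans xy].
Qed.

(** A scale index strictly between the two sides would belong to a point below
    both [x] and [y], hence below their product. *)
Lemma scale_val_smul x y :
  scale_val (smul x y) = Order.min (scale_val x) (scale_val y).
Proof.
apply/eqP; rewrite eq_le le_min !scale_val_le ?andbT /=; last 2 first.
- exact: smul_ler.
- exact: smul_lel.
rewrite leNgt; apply/negP => xy_lt.
have [_ Edense _] := scaleE.
have [||p Ep /andP[xyp]] := Edense _ _ _ xy_lt.
- by case/andP: (scale_val_itv (smul x y)).
- by rewrite ge_min; case/andP: (scale_val_itv x) => _ ->.
rewrite lt_min => /andP[px py].
have : p.1 <= scale_val (smul x y).
  apply: scale_val_ge => //; apply: sle_smul.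
    by apply: approximants_le; exact: scale_val_lt.
  by apply: approximants_le; exact: scale_val_lt.
by rewrite leNgt xyp.
Qed.

(** With [p] a scale point of intermediate index, the lower bound persists on the
    neighbourhood [upset p.2] of [z], the upper bound on the open complement of
    the closed set [upset p.2]. *)
Lemma scale_val_continuous : continuous (scale_val : X -> R).
Proof.
have [_ Edense _] := scaleE.
move=> z; apply/cvgrPdist_lt => e e0.
have /andP[z0 z1] := scale_val_itv z.
have below : \forall y \near z, scale_val z - e < scale_val y.
  have [ze|ze] := ltP (scale_val z - e) 0.
    near=> y; apply: lt_le_trans ze _.
    by case/andP: (scale_val_itv y).
  have [|p Ep /andP[zp pz]] := Edense _ (scale_val z) ze _ z1.
    by rewrite ltrBlDr ltrDl.
  apply: filterS (scale_val_lt Ep pz) => y py.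
  exact: lt_le_trans zp (scale_val_ge Ep py).
have above : \forall y \near z, scale_val y < scale_val z + e.
  have [ze|ze] := ltP 1 (scale_val z + e).
    near=> y; apply: le_lt_trans ze.
    by case/andP: (scale_val_itv y).
  have [|p Ep /andP[zp pz]] := Edense (scale_val z) _ z0 _ ze.
    by rewrite ltrDl.
  have npz : (~` upset p.2) z.
    by move=> /(scale_val_ge Ep); rewrite leNgt zp.
  have : nbhs z (~` upset p.2).
    by apply: open_nbhs_nbhs; split => //; exact/closed_openC/closed_up.
  apply: filterS => y npy; apply: le_lt_trans pz; rewrite leNgt.
  by apply/negP => /(scale_val_lt Ep)/approximants_le.
near=> y.
have : scale_val z - e < scale_val y by near: y.
have : scale_val y < scale_val z + e by near: y.
by rewrite ltr_norml; lra.
Unshelve. all: by end_near. Qed.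

End Scale.

Local Notation II := (set_type `[0%R : R, 1%R]).

Lemma U_semilattice_Ihom x y : (forall x, closed (upset x)) ->
  (forall x, closed (downset x)) -> U_semilattice X -> ~ sle x y ->
  exists2 h : X -> II, Ihom h & h x <> h y.
Proof.
move=> clup cldown UX nxy.
have [v nvy vx] := UX (~` downset y) x (closed_openC (cldown y)) nxy.
have [E scaleE [E0 E1]] := U_semilattice_scale UX vx.
have hI z : scale_val E z \in `[0, 1]%classic.
  by apply/mem_set; rewrite /= in_itv /=; exact: scale_val_itv.
exists (fun z => exist _ (scale_val E z) (hI z)).
  split; last exact: scale_val_smul.
  apply/continuousP => _ [B oB <-].
  by have /continuousP := scale_val_continuous clup scaleE; exact.
move=> /(congr1 set_val) hxy; have {}hxy : scale_val E x = scale_val E y := hxy.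
have x1 : 1 <= scale_val E x by exact: (scale_val_ge scaleE E1 (slexx x)).
have := scale_val_lt (z := y) scaleE E0; rewrite -hxy /= => /(_ (lt_le_trans ltr01 x1)).
by move/approximants_le.
Qed.

Lemma U_semilattice_I_separated : (forall x, closed (upset x)) ->
  (forall x, closed (downset x)) -> U_semilattice X -> I_separated X R.
Proof.
move=> clup cldown UX x y xy.
have [xly|nxy] := pselect (sle x y); last exact: U_semilattice_Ihom.
have [|h hh hyx] := @U_semilattice_Ihom y x clup cldown UX.
  by move=> ylx; apply: xy; exact: sle_anti.
by exists h => //; exact: nesym.
Qed.

End Urysohn.

(** * The twelve conditions *)

Theorem theorem7p1 (R : realType) (X : semitopologicalSemilatticeType)
    (X_compact : compact [set: X]) (X_hausdorff : hausdorff_space X) :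
  [<-> (open : set_system (Iweak X R)) = (open : set_system X);
       (open : set_system (weako X)) = (open : set_system X);
       (open : set_system (weakb X)) = (open : set_system X);
       hausdorff_space (weako X);
       hausdorff_space (weakb X);
       hausdorff_space (Iweak X R);
       weako_separated X;
       weakb_separated X;
       I_separated X R;
       W_semilattice X;
       U_semilattice X;
       V_semilattice X].
Proof.
have clup := closed_upset X_hausdorff.
have cldown := closed_downset X_hausdorff.
have eq_o : (open : set_system (Iweak X R)) = (open : set_system X) ->
    (open : set_system (weako X)) = (open : set_system X).
  move=> eqI; apply/seteqP; split; first exact: weako_open_sub.
  by rewrite -eqI; exact: Iweak_weako_open_sub.
have eq_b : (open : set_system (Iweak X R)) = (open : set_system X) ->
    (open : set_system (weakb X)) = (open : set_system X).
  move=> eqI; apply/seteqP; split; first exact: weakb_open_sub.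
  by rewrite -eqI; exact: Iweak_weakb_open_sub.
have hausdorff_o : (open : set_system (weako X)) = (open : set_system X) ->
    hausdorff_space (weako X).
  move=> eqo; apply: (@hausdorff_continuous_inj (weako X) X id) => //.
  by apply/continuousP => A oA; have : (open : set_system X) A by []; rewrite -eqo.
have hausdorff_b : (open : set_system (weakb X)) = (open : set_system X) ->
    hausdorff_space (weakb X).
  move=> eqb; apply: (@hausdorff_continuous_inj (weakb X) X id) => //.
  by apply/continuousP => A oA; have : (open : set_system X) A by []; rewrite -eqb.
have sepo_U : weako_separated X -> U_semilattice X.
  by move=> /weako_separated_closed; exact: separated_U.
have sepb_U : weakb_separated X -> U_semilattice X.
  by move=> /weakb_separated_closed; exact: separated_U.
have ho_U : hausdorff_space (weako X) -> U_semilattice X.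
  by move=> /hausdorff_weako_separated.
have hb_U : hausdorff_space (weakb X) -> U_semilattice X.
  by move=> /hausdorff_weakb_separated.
have U_sep : U_semilattice X -> I_separated X R.
  exact: U_semilattice_I_separated.
have U_hI : U_semilattice X -> hausdorff_space (Iweak X R).
  by move=> /U_sep; exact: I_separated_hausdorff.
have U_eqI : U_semilattice X ->
    (open : set_system (Iweak X R)) = (open : set_system X).
  by move=> /U_hI; exact: Iweak_open_eq.
tfae.
- exact: eq_o.
- by move=> /hausdorff_o/ho_U/U_eqI; exact: eq_b.
- by move=> /hausdorff_b/hb_U/U_eqI/eq_o.
- by move=> /ho_U/U_eqI/eq_b.
- by move=> /hb_U.
- by move=> /Iweak_hausdorff_weako/hausdorff_weako_separated.
- by move=> /sepo_U/U_eqI/eq_b/hausdorff_b/hausdorff_weakb_separated.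
- by move=> /sepb_U.
- move=> /I_separated_hausdorff/Iweak_hausdorff_weako/ho_U.
  exact: U_semilattice_W.
- exact: W_semilattice_U.
- exact: U_semilattice_V.
- by move=> /V_semilattice_U UX; apply: U_eqI; exact: UX.
Qed.
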